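(* Suppose that $f \colon \mathbb{N} \times \mathbb{N} \to \mathbb{Z}$ is bimonotone and proper in the sense that for every $z \in \mathbb{Z}$ only finitely many pairs $(a,b)\in\mathbb{N}\times\mathbb{N}$ satisfy $f(a,b)\le z$. Then the bimonotone enumeration algorithm (described in the context, with $A=B=\mathbb{N}$) produces a stream enumerating all pairs $(a,b) \in \mathbb{N} \times \mathbb{N}$ (each exactly once) such that the values $f(a,b)$ appear in increasing (i.e. non-decreasing) order. While enumerating the first $n$ values, the algorithm only builds up a priority queue of length $m \le \sqrt{2n}+1$. If $f$ is a polynomial, the algorithm takes time $O( n \log^2 n )$ and requires memory $O( \sqrt{n} \log n )$ to enumerate the first $n$ values, where time and memory are measured in bit-complexity and the hidden constants may depend on $f$.
   Context: $\mathbb{N}=\{0,1,2,\dots\}$. A function $f\colon A\times B\to Z$ between totally ordered sets $A,B$ and a totally ordered set $Z$ is bimonotone if $a\le a'$ and $b\le b'$ imply $f(a,b)\le f(a',b')$. Bimonotone enumeration algorithm. For $a\in A$ let $\sigma a$ denote the successor of $a$ in $A$ (with $\sigma a=+\infty$ if $a$ is the greatest element), and similarly for $b\in B$; let $a_{\min},b_{\min}$ be the least elements. The algorithm maintains a doubly linked list $M$ of pairs in $A\times B$ and a priority queue $F$ containing the values $f(a,b)$ for $(a,b)\in M$, each stored with a pointer to its pair $(a,b)$ in $M$. By convention the predecessor of the first element of $M$ is $(-\infty,+\infty)$ and the successor of the last element of $M$ is $(+\infty,-\infty)$. (1) Initialize $M=\langle (a_{\min},b_{\min})\rangle$ and $F=\langle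 f(a_{\min},b_{\min})\rangle$. (2) While $F$ is non-empty: remove a minimal element $f(a,b)$ from $F$ and output $(a,b)$; let $(a^*,b_* )$ be the successor of $(a,b)$ in $M$; if $\sigma a<a^*$, insert $(\sigma a,b)$ into $M$ right after $(a,b)$ and insert $f(\sigma a,b)$ into $F$; let $(a_*,b^* )$ be the predecessor of $(a,b)$ in $M$; if $\sigma b<b^*$, insert $(a,\sigma b)$ into $M$ right after $(a,b)$ and insert $f(a,\sigma b)$ into $F$; remove $(a,b)$ from $M$. Cost model for bit-complexity: when $n$ elements are enumerated, storing an element $(f(a,b),a,b)$ takes memory $O(\log n)$, and calculating, copying and comparing such elements takes time $O(\log n)$ (factors of order $\log\log n$ or less are neglected); each list operation (finding successor/predecessor, inserting right after a given element, removing) costs time $O(\log n)$; each insertion into, or extraction of a minimum from, a priority queue of length $m$ takes $O(\log m)$ elementary steps on elements, i.e. time $O(\log n\,\log m)$. *)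

(* Defs.v *)
From HB Require Import structures.
From mathcomp Require Import all_boot all_order all_algebra.
From mathcomp Require Import classical_sets cardinality reals exp.
Set Implicit Arguments.
Unset Strict Implicit.
Unset Printing Implicit Defensive.
Import Order.TTheory GRing.Theory Num.Theory.
Local Open Scope nat_scope.

Definition bimonotone (dA dB dZ : Order.disp_t) (A : orderType dA)
    (B : orderType dB) (Z : orderType dZ) (f : A -> B -> Z) : Prop :=
  forall a a' b b', (a <= a')%O -> (b <= b')%O -> (f a b <= f a' b')%O.

Definition proper_fun (f : nat -> nat -> int) : Prop :=
  forall z : int, finite_set [set p : nat * nat | (f p.1 p.2 <= z)%R].

(* Integer-valued polynomials need not have integer coefficients, as in
   a + (a + b) * (a + b + 1) / 2, so the coefficients are taken in R. *)
Definition is_polynomial (R : realType) (f : nat -> nat -> int) : Prop :=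
  exists p : {poly {poly R}},
    forall a b : nat, ((f a b)%:~R = p.[(b%:R)%:P].[a%:R])%R.

(* A queue entry is a value together with a pointer to a node of the list M.
   The nodes of M carry pairwise distinct pairs, so the pair serves as the
   pointer. *)
Definition entry : Type := (int * (nat * nat))%type.

Definition entry_of (f : nat -> nat -> int) (p : nat * nat) : entry :=
  (f p.1 p.2, p).

(* The priority queue is the collection of its entries; the order of the
   sequence [queue] has no meaning. *)
Record state := State { pairs : seq (nat * nat); queue : seq entry }.

(* [None] stands for the conventional neighbours (+oo, -oo) of the last element
   and (-oo, +oo) of the first one. *)
Definition list_succ (M : seq (nat * nat)) (p : nat * nat) :
    option (nat * nat) :=
  onth M (index p M).+1.

Definition list_pred (M : seq (nat * nat)) (p : nat * nat) :
    option (nat * nat) :=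
  if index p M is i.+1 then onth M i else None.

Definition insert_after (M : seq (nat * nat)) (p q : nat * nat) :
    seq (nat * nat) :=
  take (index p M).+1 M ++ q :: drop (index p M).+1 M.

(* Only the coordinates of the neighbours that may be +oo are ever compared. *)
Definition lt_pinfty (x : nat) (y : option nat) : bool :=
  if y is Some y' then x < y' else true.

Definition fits_a (M : seq (nat * nat)) (p : nat * nat) : bool :=
  lt_pinfty p.1.+1 (omap fst (list_succ M p)).

Definition fits_b (M : seq (nat * nat)) (p : nat * nat) : bool :=
  lt_pinfty p.2.+1 (omap snd (list_pred M p)).

Definition extract (e : entry) (s : state) : state :=
  State (pairs s) (rem e (queue s)).

Definition push (f : nat -> nat -> int) (p q : nat * nat) (s : state) : state :=
  State (insert_after (pairs s) p q) (entry_of f q :: queue s).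

Definition extend_a (f : nat -> nat -> int) (p : nat * nat) (s : state) :
    state :=
  if fits_a (pairs s) p then push f p (p.1.+1, p.2) s else s.

Definition extend_b (f : nat -> nat -> int) (p : nat * nat) (s : state) :
    state :=
  if fits_b (pairs s) p then push f p (p.1, p.2.+1) s else s.

Definition delete (p : nat * nat) (s : state) : state :=
  State (rem p (pairs s)) (queue s).

(* The successive states reached by one iteration of the loop from [s], when
   [e] is the entry extracted from the queue. *)
Definition body (f : nat -> nat -> int) (e : entry) (s : state) : seq state :=
  let s1 := extract e s in
  let s2 := extend_a f e.2 s1 in
  let s3 := extend_b f e.2 s2 in
  [:: s1; s2; s3; delete e.2 s3].

Definition init (f : nat -> nat -> int) : state :=
  State [:: (0, 0)] [:: entry_of f (0, 0)].

(* [x k F] is the entry extracted from the queue F in iteration k; any way of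
   breaking ties between equal values is allowed. *)
Definition extracts_min (x : nat -> seq entry -> entry) : Prop :=
  forall (k : nat) (F : seq entry), F <> [::] ->
    x k F \in F /\ forall e, e \in F -> ((x k F).1 <= e.1)%R.

(* The state after k iterations; it remains constant if the queue becomes
   empty, that is, if the algorithm halts. *)
Fixpoint run (f : nat -> nat -> int) (x : nat -> seq entry -> entry) (k : nat) :
    state :=
  if k is j.+1 then
    let s := run f x j in
    if nilp (queue s) then s else last s (body f (x j (queue s)) s)
  else init f.

(* [None] if the algorithm halts before iteration k. *)
Definition output (f : nat -> nat -> int) (x : nat -> seq entry -> entry)
    (k : nat) : option (nat * nat) :=
  let s := run f x k in
  if nilp (queue s) then None else Some (x k (queue s)).2.

(* All states, including those inside the loop body, that occur while the first
   n elements are enumerated. *)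
Definition trace (f : nat -> nat -> int) (x : nat -> seq entry -> entry)
    (n : nat) : seq state :=
  init f :: flatten [seq let s := run f x k in
                         if nilp (queue s) then [::]
                         else body f (x k (queue s)) s | k <- iota 0 n].

Definition max_queue_length (f : nat -> nat -> int)
    (x : nat -> seq entry -> entry) (n : nat) : nat :=
  \max_(s <- trace f x n) size (queue s).

(* Equals 1 for n = 0, so that it can serve as a positive "log n". *)
Definition bit_length (n : nat) : nat := (trunc_log 2 n).+1.

Definition entry_bits (e : entry) : nat :=
  bit_length `|e.1|%N + bit_length e.2.1 + bit_length e.2.2.

(* Costs in bits and bit operations; the argument n is the total number of
   elements to be enumerated. The term [bit_length n] in the bounds for entries
   covers pointers; that [entry_bits] is itself O(log n) for the entries that
   occur is not postulated. *)
Record cost_model := CostModel {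
  (* storing an entry, with its pointers *)
  entry_space : nat -> entry -> nat;
  (* calculating, copying or comparing an entry once *)
  entry_time : nat -> entry -> nat;
  (* finding a neighbour, inserting after a given node, removing a node *)
  list_time : nat -> nat;
  (* steps on entries in an operation on a priority queue of length m *)
  queue_steps : nat -> nat;
  cost_constant : nat;
  entry_spaceP : forall n e,
    entry_space n e <= cost_constant * (bit_length n + entry_bits e);
  entry_timeP : forall n e,
    entry_time n e <= cost_constant * (bit_length n + entry_bits e);
  list_timeP : forall n, list_time n <= cost_constant * bit_length n;
  queue_stepsP : forall m, queue_steps m <= cost_constant * bit_length m
}.

Definition queue_time (c : cost_model) (n : nat) (F : seq entry) : nat :=
  queue_steps c (size F) * \max_(e <- F) entry_time c n e.

(* Find the neighbour [o], calculate the candidate [q], compare it with [o] and,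
   if [ins] holds, insert it into the list and into the queue, which thereby
   becomes [F]. *)
Definition extend_time (c : cost_model) (f : nat -> nat -> int) (n : nat)
    (o : option (nat * nat)) (q : nat * nat) (ins : bool) (F : seq entry) :
    nat :=
  list_time c n
  + entry_time c n (entry_of f q)
  + (entry_time c n (entry_of f q)
     + oapp (fun q' => entry_time c n (entry_of f q')) 0 o)
  + (if ins then list_time c n + queue_time c n F else 0).

(* The second summand is the cost of the output. *)
Definition body_time (c : cost_model) (f : nat -> nat -> int) (n : nat)
    (e : entry) (s : state) : nat :=
  let p := e.2 in
  let s1 := extract e s in
  let s2 := extend_a f p s1 in
  let s3 := extend_b f p s2 in
  queue_time c n (queue s)
  + entry_time c n e
  + extend_time c f n (list_succ (pairs s1) p) (p.1.+1, p.2)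
      (fits_a (pairs s1) p) (queue s2)
  + extend_time c f n (list_pred (pairs s2) p) (p.1, p.2.+1)
      (fits_b (pairs s2) p) (queue s3)
  + list_time c n.

Definition init_time (c : cost_model) (f : nat -> nat -> int) (n : nat) : nat :=
  entry_time c n (entry_of f (0, 0)) + list_time c n
  + queue_time c n (queue (init f)).

Definition total_time (c : cost_model) (f : nat -> nat -> int)
    (x : nat -> seq entry -> entry) (n : nat) : nat :=
  init_time c f n
  + \sum_(k < n) (let s := run f x k in
                  if nilp (queue s) then 0
                  else body_time c f n (x k (queue s)) s).

Definition state_space (c : cost_model) (f : nat -> nat -> int) (n : nat)
    (s : state) : nat :=
  \sum_(p <- pairs s) entry_space c n (entry_of f p)
  + \sum_(e <- queue s) entry_space c n e.

Definition total_space (c : cost_model) (f : nat -> nat -> int)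
    (x : nat -> seq entry -> entry) (n : nat) : nat :=
  \max_(s <- trace f x n) state_space c f n s.

(* Main.v *)
Require Import Defs.
From HB Require Import structures.
From mathcomp Require Import all_boot all_order all_algebra zify lra.
From mathcomp Require Import classical_sets cardinality reals exp.
Set Implicit Arguments.
Unset Strict Implicit.
Unset Printing Implicit Defensive.
Import Order.TTheory GRing.Theory Num.Theory.
Local Open Scope nat_scope.

(** The pairs output so far form a lower set D of the product order, and the
    list M is the antichain of minimal elements of its complement, ordered as a
    staircase. By bimonotonicity the smallest value on M is the smallest value
    on the whole complement, so the output is sorted; by properness no pair can
    be overtaken infinitely often, so every pair is output. If M has m elements,
    the triangle of pairs (i, j) with i + j < m - 1 lies below the staircase, so
    that m (m - 1) / 2 <= #|D|. After k steps all coordinates in M are at most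
    k, hence for polynomial f the entries have O(log n) bits. *)

(** * Staircases, and the list operations around a given node *)

Definition stair (p q : nat * nat) : bool := (p.1 < q.1) && (q.2 < p.2).

Definition le2 (p q : nat * nat) : bool := (p.1 <= q.1) && (p.2 <= q.2).

(** [enters_a] and [enters_b] are the tests [fits_a] and [fits_b] for a list already split as
    [l ++ p :: r], where the neighbours of [p] are the head of [r] and the last element of [l]. *)
Definition enters_a (p : nat * nat) (r : seq (nat * nat)) : bool :=
  lt_pinfty p.1.+1 (omap fst (ohead r)).

Definition enters_b (p : nat * nat) (l : seq (nat * nat)) : bool :=
  lt_pinfty p.2.+1 (omap snd (ohead (rev l))).

(** A list of length 0 or 1, so that accepted and rejected candidates are treated by one formula. *)
Definition next_a (p : nat * nat) (r : seq (nat * nat)) :=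
  nseq (enters_a p r) (p.1.+1, p.2).

Definition next_b (p : nat * nat) (l : seq (nat * nat)) :=
  nseq (enters_b p l) (p.1, p.2.+1).

(** Nodes are located by [index], which finds the first occurrence; hence the condition
    [p \notin l]. *)
Lemma list_succ_cat (l r : seq (nat * nat)) (p : nat * nat) :
  p \notin l -> list_succ (l ++ p :: r) p = ohead r.
Proof.
move=> pl; rewrite /list_succ index_cat (negPf pl) index_head addn0.
rewrite onth_cat ltnNge leqnSn /= subSn // subnn; by case: r.
Qed.

Lemma list_pred_cat (l r : seq (nat * nat)) (p : nat * nat) :
  p \notin l -> list_pred (l ++ p :: r) p = ohead (rev l).
Proof.
case/lastP: l => [|l q] pl; first by rewrite /list_pred /= eqxx.
rewrite /list_pred index_cat (negPf pl) index_head addn0 size_rcons rev_rcons /=.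
by rewrite onth_cat size_rcons leqnn -cats1 onth_cat ltnn subnn.
Qed.

Lemma insert_after_cat (l r : seq (nat * nat)) (p q : nat * nat) :
  p \notin l -> insert_after (l ++ p :: r) p q = l ++ p :: q :: r.
Proof.
move=> pl; rewrite /insert_after index_cat (negPf pl) index_head addn0.
rewrite take_cat drop_cat ltnNge leqnSn /= subSn // subnn /= take0 drop0.
by rewrite -catA.
Qed.

Lemma extend_aE f (l r : seq (nat * nat)) (p : nat * nat) F : p \notin l ->
  extend_a f p (State (l ++ p :: r) F) =
  State (l ++ p :: next_a p r ++ r) (map (entry_of f) (next_a p r) ++ F).
Proof.
move=> pl; rewrite /extend_a /fits_a /= list_succ_cat // /next_a /enters_a.
by case: lt_pinfty => //=; rewrite /push /= insert_after_cat.
Qed.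

Lemma extend_bE f (l r : seq (nat * nat)) (p : nat * nat) F : p \notin l ->
  extend_b f p (State (l ++ p :: r) F) =
  State (l ++ p :: next_b p l ++ r) (map (entry_of f) (next_b p l) ++ F).
Proof.
move=> pl; rewrite /extend_b /fits_b /= list_pred_cat // /next_b /enters_b.
by case: lt_pinfty => //=; rewrite /push /= insert_after_cat.
Qed.

(** The first insertion changes only what follows [e.2], so the second test still sees [l]. The
    second candidate, also inserted right after [e.2], ends up before the first, as the staircase
    order demands. *)
Lemma bodyE f e (l r : seq (nat * nat)) F : e.2 \notin l ->
  body f e (State (l ++ e.2 :: r) F) =
  let a := next_a e.2 r in let b := next_b e.2 l in
  let F1 := rem e F in let F2 := map (entry_of f) a ++ F1 in
  let F3 := map (entry_of f) b ++ F2 in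
  [:: State (l ++ e.2 :: r) F1; State (l ++ e.2 :: a ++ r) F2;
      State (l ++ e.2 :: b ++ a ++ r) F3; State (l ++ b ++ a ++ r) F3].
Proof.
move=> pl; rewrite /body /extract /= extend_aE // extend_bE // /delete /=.
rewrite [rem e.2 _]remE index_cat (negPf pl) index_head addn0 take_size_cat //.
by rewrite drop_cat ltnNge leqnSn /= subSn // subnn /= drop0.
Qed.

(* [d] lists the pairs output so far; the third condition says that [pairs s]
   generates the complement of [d] as an upper set. *)
Record loop_invariant (f : nat -> nat -> int) (d : seq (nat * nat)) (s : state) :
    Prop := Invariant {
  inv_stair : pairwise stair (pairs s);
  inv_uniq : uniq d;
  inv_mem : forall q, (q \in d) = ~~ has (le2^~ q) (pairs s);
  inv_queue : perm_eq (queue s) (map (entry_of f) (pairs s))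
}.

Lemma invariant_init f : loop_invariant f [::] (init f).
Proof. by split=> // q; rewrite /= in_nil. Qed.

(** * One iteration preserves the loop invariant *)

Section Step.

Variables (p : nat * nat) (l r : seq (nat * nat)).
Hypothesis stair_lpr : pairwise stair (l ++ p :: r).

Lemma stair_left q : q \in l -> stair q p.
Proof.
move: stair_lpr; rewrite pairwise_cat => /and3P[/allrelP H _ _] ql.
by apply: H => //; rewrite mem_head.
Qed.

Lemma stair_right q : q \in r -> stair p q.
Proof.
move: stair_lpr; rewrite pairwise_cat => /and3P[_ _ /= /andP[/allP H _]].
exact: H.
Qed.

Lemma stair_notin_left : p \notin l.
Proof. by apply/negP => /stair_left; rewrite /stair ltnn. Qed.

(** The test looks at the nearest neighbour only; along the staircase the inequality spreads to all
    of [r]. *)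
Lemma enters_aP q : enters_a p r -> q \in r -> p.1.+1 < q.1.
Proof.
move: stair_lpr; rewrite pairwise_cat /enters_a => /and3P[_ _].
case: r => [|r0 r'] //= /and3P[_ /allP r0r _] lt_p_r0.
by rewrite inE => /predU1P[->//|/r0r]; case/andP=> + _; apply: ltn_trans.
Qed.

Lemma enters_bP q : enters_b p l -> q \in l -> p.2.+1 < q.2.
Proof.
move: stair_lpr; rewrite pairwise_cat /enters_b => /and3P[_ + _].
case/lastP: l => [|l' l0] //=; rewrite rev_rcons -cats1 pairwise_cat /=.
case/and3P=> /allrelP ll0 _ _ lt_p_l0; rewrite mem_cat inE.
case/orP=> [/ll0|/eqP->//]; move/(_ l0 (mem_head _ _)); case/andP=> _.
exact: ltn_trans.
Qed.

(** Raising a coordinate of [p] can only spoil the comparison of [(p.1, p.2.+1)] with [l] and of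
    [(p.1.+1, p.2)] with [r]; these are what the two tests guarantee. The other comparisons are
    inherited from [p]. *)
Lemma stair_step : pairwise stair (l ++ next_b p l ++ next_a p r ++ r).
Proof.
have stl := stair_left; have str := stair_right.
have ea := enters_aP; have eb := enters_bP.
move: stair_lpr; rewrite !pairwise_cat => /and3P[/allrelP lr -> /= /andP[_ ->]].
rewrite !allrel_catr /next_a /next_b.
have -> : allrel stair l r
  by apply/allrelP => x y xl yr; rewrite lr // inE yr orbT.
have -> : allrel stair l (nseq (enters_b p l) (p.1, p.2.+1)).
  apply/allrelP => x y xl; rewrite mem_nseq; case: (enters_b _ _) eb => //= eb.
  move/eqP ->; rewrite /stair /=; have/andP[-> _] := stl _ xl.
  by rewrite eb.
have -> : allrel stair l (nseq (enters_a p r) (p.1.+1, p.2)).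
  apply/allrelP => x y xl; rewrite mem_nseq => /andP[_ /eqP->].
  by have/andP[h1 h2] := stl _ xl; rewrite /stair /= h2 ltnS ltnW.
have -> : allrel stair (nseq (enters_b p l) (p.1, p.2.+1)) r.
  apply/allrelP => x y; rewrite mem_nseq => /andP[_ /eqP->] /str/andP[h1 h2].
  by rewrite /stair /= h1 ltnS ltnW.
have -> : allrel stair (nseq (enters_a p r) (p.1.+1, p.2)) r.
  apply/allrelP => x y; rewrite mem_nseq; case: (enters_a _ _) ea => //= ea.
  move/eqP-> => yr; rewrite /stair /=; have/andP[_ ->] := str _ yr.
  by rewrite ea.
by case: enters_a; case: enters_b => //=; rewrite /allrel /= /stair /= !ltnSn.
Qed.

(** Replacing [p] by its candidates removes exactly [p] from the generated upper set: a pair above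
    [p] and distinct from it exceeds [p] in some coordinate, so it lies above a candidate, and a
    rejected candidate lies above a neighbour of [p]. *)
Lemma has_le2_step q :
  has (le2^~ q) (l ++ next_b p l ++ next_a p r ++ r) =
  (q != p) && has (le2^~ q) (l ++ p :: r).
Proof.
apply/hasP/andP => [[m]|[qp /hasP[m]]]; rewrite !mem_cat ?inE.
  case/or4P=> [ml|mb|ma|mr] mq.
  - split; last by apply/hasP; exists m; rewrite // mem_cat ml.
    apply: contraTneq mq => ->; have/andP[_ h] := stair_left ml.
    by rewrite /le2 (leqNgt m.2) h andbF.
  - move: mb mq; rewrite mem_nseq => /andP[_ /eqP->]; rewrite /le2 /= => mq.
    split; first by apply: contraTneq mq => ->; rewrite ltnn andbF.
    apply/hasP; exists p; first by rewrite mem_cat mem_head orbT.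
    by case/andP: mq => -> /ltnW.
  - move: ma mq; rewrite mem_nseq => /andP[_ /eqP->]; rewrite /le2 /= => mq.
    split; first by apply: contraTneq mq => ->; rewrite ltnn.
    apply/hasP; exists p; first by rewrite mem_cat mem_head orbT.
    by case/andP: mq => /ltnW -> ->.
  - split; last by apply/hasP; exists m; rewrite // mem_cat inE mr !orbT.
    apply: contraTneq mq => ->; have/andP[h _] := stair_right mr.
    by rewrite /le2 (leqNgt m.1) h.
case/or3P=> [ml|/eqP->|mr].
- by exists m; rewrite // !mem_cat ml.
- case/andP=> h1 h2.
  have [h|h] := ltnP p.1 q.1.
    have [ea|] := boolP (enters_a p r).
      exists (p.1.+1, p.2); last by rewrite /le2 /= h h2.
      by rewrite !mem_cat /next_a ea mem_head !orbT.
    (* The candidate was rejected, so [r] has a head [r0] with [r0.1 <= p.1.+1]; since also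
       [r0.2 < p.2], this [r0] lies below [q]. *)
    rewrite /enters_a; case: r stair_right => //= r0 r' /(_ r0 (mem_head _ _)).
    case/andP=> _ h3; rewrite -leqNgt => h4.
    exists r0; first by rewrite !mem_cat mem_head !orbT.
    by rewrite /le2 (leq_trans h4 h) (leq_trans (ltnW h3) h2).
  have {}h : p.2 < q.2.
    rewrite ltn_neqAle h2 andbT; apply: contra_neq qp => h3.
    by rewrite [q]surjective_pairing [p]surjective_pairing h3;
      congr (_, _); apply/eqP; rewrite eqn_leq h h1.
  have [eb|] := boolP (enters_b p l).
    exists (p.1, p.2.+1); last by rewrite /le2 /= h h1.
    by rewrite !mem_cat /next_b eb mem_head !orbT.
  rewrite /enters_b; case/lastP: l stair_left => // l' l0.
  rewrite rev_rcons /= => /(_ l0); rewrite mem_rcons mem_head.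
  move=> /(_ isT)/andP[h3 _]; rewrite -leqNgt => h4.
  exists l0; first by rewrite !mem_cat mem_rcons mem_head.
  by rewrite /le2 (leq_trans h4 h) (leq_trans (ltnW h3) h1).
- by exists m; rewrite // !mem_cat mr !orbT.
Qed.

End Step.

Lemma invariant_split f d s e : loop_invariant f d s -> e \in queue s ->
  e = entry_of f e.2 /\
  exists l r, [/\ pairs s = l ++ e.2 :: r, e.2 \notin l &
                  pairwise stair (l ++ e.2 :: r)].
Proof.
move=> [st _ _ /perm_mem ->] /mapP[p ps ->]; split=> //=.
case/splitPr: ps st => l r st; exists l, r; split=> //.
exact: stair_notin_left st.
Qed.

Lemma invariant_body f d s e : loop_invariant f d s -> e \in queue s ->
  loop_invariant f (rcons d e.2) (last s (body f e s)).
Proof.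
move=> inv es; have [ef [l [r [sE pl st]]]] := invariant_split inv es.
case: s sE inv es => M F; rewrite [pairs _]/= => -> [_ ud memd qF] eF.
rewrite bodyE //; split=> /=; first exact: stair_step.
- rewrite rcons_uniq ud andbT memd negbK; apply/hasP; exists e.2.
    by rewrite mem_cat mem_head orbT.
  by rewrite /le2 !leqnn.
- move=> q; rewrite has_le2_step // negb_and negbK -memd.
  by rewrite mem_rcons inE.
rewrite !map_cat perm_sym perm_catC -!catA perm_cat2l perm_cat2l.
(* The entries of the candidates have cancelled; what remains compares [rem e F] with the entries of
   [l] and [r]. Adding [e] to both sides gives back the invariant of the old queue. *)
rewrite perm_catC -(perm_cons e).
have/permPr <- : perm_eq F (e :: rem e F) by apply: perm_to_rem.
rewrite perm_sym (permPl qF) map_cat /= -ef.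
by rewrite -cat1s perm_catCA perm_cat2l.
Qed.

(** * Counting: nonemptiness, coordinates and length of the queue *)

Lemma leq_size_inj (T : eqType) (g : nat -> T) n (d : seq T) :
  injective g -> (forall i, i < n -> g i \in d) -> n <= size d.
Proof.
move=> g_inj gd; rewrite -(size_mkseq g n); apply: uniq_leq_size.
  exact: mkseq_uniq.
by move=> _ /mapP[i + ->]; rewrite mem_iota => /gd.
Qed.

(** An empty list would generate the empty upper set, and the finite list [d] would contain a whole
    axis. *)
Lemma invariant_nonempty f d s : loop_invariant f d s -> queue s <> [::].
Proof.
case=> _ ud memd /perm_size; rewrite size_map => sz q0.
have M0 : pairs s = [::] by apply: size0nil; rewrite -sz q0.
suff: (size d).+1 <= size d by rewrite ltnn.
apply: (@leq_size_inj _ (fun i => (i, 0))) => [i j []|i _] //.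
by rewrite memd M0.
Qed.

(** The list is an antichain, so every pair strictly below [p] is in [d]; this applies to the [p.1]
    pairs to the left of [p] in its row and to the [p.2] pairs below it in its column. *)
Lemma invariant_coord f d s p : loop_invariant f d s -> p \in pairs s ->
  p.1 <= size d /\ p.2 <= size d.
Proof.
case=> st ud memd _ ps.
have anti q : le2 q p -> q != p -> q \in d.
  move=> qp nqp; rewrite memd; apply/hasPn => m ms /=; apply: contra nqp => mq.
  case/splitPr: ps st ms => l r st; rewrite mem_cat inE.
  move: mq qp; rewrite /le2 => /andP[h1 h2] /andP[h3 h4].
  case/or3P=> [/(stair_left st)|/eqP mp|/(stair_right st)].
  - by move/andP=> [_]; rewrite ltnNge (leq_trans h2 h4).
  - rewrite [q]surjective_pairing [p]surjective_pairing xpair_eqE !eqn_leq.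
    by rewrite h3 h4 -mp h1 h2.
  - by move/andP=> [+ _]; rewrite ltnNge (leq_trans h1 h3).
split.
- apply: (@leq_size_inj _ (fun i => (i, p.2))) => [i j []|i ip] //.
  apply: anti; first by rewrite /le2 /= leqnn ltnW.
  by apply: contraTneq ip => <- /=; rewrite ltnn.
- apply: (@leq_size_inj _ (fun i => (p.1, i))) => [i j []|i ip] //.
  apply: anti; first by rewrite /le2 /= leqnn ltnW.
  by apply: contraTneq ip => <- /=; rewrite ltnn.
Qed.

(** The elements before [m] have distinct first coordinates less than [m.1], those after it distinct
    second coordinates less than [m.2]. *)
Lemma stair_sum (M : seq (nat * nat)) m :
  pairwise stair M -> m \in M -> size M <= (m.1 + m.2).+1.
Proof.
move=> st mM; case/splitPr: mM st => l r st.
rewrite size_cat /= addnS ltnS leq_add //.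
- have stl := stair_left st; move: st; rewrite pairwise_cat => /and3P[_ st _].
  have := @uniq_leq_size _ (map fst l) (iota 0 m.1).
  rewrite size_map size_iota; apply.
    rewrite uniq_pairwise pairwise_map; apply: sub_pairwise st => x y /andP[+ _].
    by move=> /= h; rewrite neq_ltn h.
  by move=> x /mapP[q /stl/andP[h _] ->]; rewrite mem_iota.
- have str := stair_right st; move: st; rewrite pairwise_cat.
  move=> /and3P[_ _ /= /andP[_ st]].
  have := @uniq_leq_size _ (map snd r) (iota 0 m.2).
  rewrite size_map size_iota; apply.
    rewrite uniq_pairwise pairwise_map; apply: sub_pairwise st => x y /andP[_].
    by move=> /= h; rewrite neq_ltn h orbT.
  by move=> x /mapP[q /str/andP[_ h] ->]; rewrite mem_iota.
Qed.

Definition triangle (n : nat) : seq (nat * nat) :=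
  [seq (i, j) | i <- iota 0 n, j <- iota 0 (n - i)].

Lemma mem_triangle n q : q \in triangle n -> q.1 + q.2 < n.
Proof.
case/allpairsPdep=> i [j []]; rewrite !mem_iota /= => h1 h2 -> /=; lia.
Qed.

Lemma triangle_uniq n : uniq (triangle n).
Proof.
apply: allpairs_uniq_dep; rewrite ?iota_uniq //.
  by move=> *; exact: iota_uniq.
by move=> [i j] [i' j'] _ _ /= [-> ->].
Qed.

Lemma size_triangle n : size (triangle n) = 'C(n.+1, 2).
Proof.
rewrite size_allpairs_dep sumnE big_map -{1}[n]subn0 -/(index_iota 0 n).
rewrite big_nat_rev /= -bin2_sum big_nat_recl //= add0n.
by apply: eq_big_nat => i /andP[_ h]; rewrite size_iota subKn.
Qed.

(** If the list has [m.+1] elements, each has coordinate sum at least [m] by [stair_sum], so none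
    lies below a pair of [triangle m], and that triangle is contained in [d]. *)
Lemma invariant_size f d s : loop_invariant f d s ->
  size (queue s) * (size (queue s)).-1 <= (size d).*2.
Proof.
case=> st ud memd /perm_size; rewrite size_map => ->.
case E: (size (pairs s)) => [//|m].
have tri_d : {subset triangle m <= d}.
  move=> q /mem_triangle qm; rewrite memd; apply/hasPn => p /(stair_sum st).
  rewrite E ltnS => mp; apply: contraL qm => /andP[p1 p2].
  by rewrite -leqNgt (leq_trans mp) // leq_add.
have := uniq_leq_size (triangle_uniq m) tri_d.
rewrite size_triangle bin2 /= -leq_double => h; apply: leq_trans h.
(* The product of consecutive numbers is even, so nothing is lost in halving. *)
by rewrite halfK oddM /= andNb subn0.
Qed.

(** * The output stream: no repetition, monotone values, exhaustiveness *)

Definition chosen (f : nat -> nat -> int) (x : nat -> seq entry -> entry)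
    (k : nat) : entry :=
  x k (queue (run f x k)).

Section Run.

Variables (f : nat -> nat -> int) (x : nat -> seq entry -> entry).
Hypothesis xP : extracts_min x.

Local Notation out k := (chosen f x k).2.

Lemma run_invariant k : loop_invariant f (mkseq (fun k => out k) k) (run f x k).
Proof.
elim: k => [|k IHk]; first exact: invariant_init.
have q0 := invariant_nonempty IHk.
rewrite /= mkseqS; case: ifP => [/nilP//|_].
by apply: invariant_body => //; have [] := xP k q0.
Qed.

Lemma queue_run k : nilp (queue (run f x k)) = false.
Proof. by apply/nilP/(invariant_nonempty (run_invariant k)). Qed.

Lemma chosen_mem k : chosen f x k \in queue (run f x k).
Proof. by have [] := xP k (invariant_nonempty (run_invariant k)). Qed.

Lemma out_uniq k : uniq (mkseq (fun k => out k) k).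
Proof. exact: inv_uniq (run_invariant k). Qed.

Lemma out_inj : injective (fun k => out k).
Proof.
move=> i j; wlog ij : i j / i < j.
  by move=> H; have [/H|/H h /esym/h|] := ltngtP i j.
move=> E; have := out_uniq j.+1; rewrite mkseqS rcons_uniq -E.
by rewrite (map_f (fun k => out k)) // mem_iota.
Qed.

Lemma chosen_entry k : chosen f x k = entry_of f (out k).
Proof. by have [] := invariant_split (run_invariant k) (chosen_mem k). Qed.

Hypothesis f_mono : bimonotone f.

(** A pair not yet output lies above some [m] in the list. The extracted value is at most the value
    at [m], which bimonotonicity bounds by the value at [q]. *)
Lemma out_min k q : q \notin mkseq (fun k => out k) k ->
  (f (out k).1 (out k).2 <= f q.1 q.2)%R.
Proof.
have [_ _ memd qE] := run_invariant k.
rewrite memd negbK => /hasP[m ms /andP[m1 m2]].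
have [_ /(_ (entry_of f m))] := xP k (invariant_nonempty (run_invariant k)).
rewrite (perm_mem qE) map_f // => /(_ isT).
rewrite -[x k _]/(chosen f x k) chosen_entry /= => h; apply: le_trans h _.
exact: f_mono.
Qed.

Lemma out_mono j k : j <= k ->
  (f (out j).1 (out j).2 <= f (out k).1 (out k).2)%R.
Proof.
move=> jk; apply: out_min; apply/negP => /mapP[i].
by rewrite mem_iota => /= ij /out_inj E; move: ij; rewrite -E ltnNge jk.
Qed.

Hypothesis f_proper : proper_fun f.

(** Let [S] list the pairs of value at most [f q.1 q.2]. If [q] were missing from the first
    [(size S).+1] outputs, these distinct pairs would all belong to [S] by [out_min]. The boolean
    equality lets [xchoose] produce an inverse of the output function. *)
Lemma out_surj q : exists k, out k == q.
Proof.
have /finite_seqP[S SE] := f_proper (f q.1 q.2).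
have [/mapP[k _ ->]|qk] := boolP (q \in mkseq (fun k => out k) (size S).+1).
  by exists k.
suff: (size S).+1 <= size S by rewrite ltnn.
apply: (leq_size_inj out_inj) => i iS.
suff: [set` S]%classic (out i) by [].
rewrite -SE /=; apply: out_min; apply: contra qk => /mapP[j + ->].
rewrite mem_iota => /= ji; apply: (map_f (fun k => out k)); rewrite mem_iota /=.
by rewrite (ltn_trans ji).
Qed.

Lemma out_bij : bijective (fun k => out k).
Proof.
pose g q := xchoose (out_surj q).
have gK q : out (g q) = q by apply/eqP; exact: (xchooseP (out_surj q)).
by exists g => [k|q] //; apply: out_inj.
Qed.

End Run.

(** * States inside the loop body: queue length and range of coordinates *)

Lemma bigmax_all (T : Type) (Q : pred nat) (F : T -> nat) (s : seq T) :
  Q 0 -> all (fun t => Q (F t)) s -> Q (\max_(t <- s) F t).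
Proof.
move=> Q0; elim: s => [|t s IHs] /=; first by rewrite big_nil.
by rewrite big_cons /maxn => /andP[? /IHs ?]; case: ifP.
Qed.

(** A maximum is 0 or one of the values, so it inherits any predicate. [Q] is left general to cover
    both the quadratic bound on the queue length and a real bound on the memory. *)
Lemma max_trace f x n (F : state -> nat) (Q : pred nat) : extracts_min x ->
  Q 0 -> Q (F (init f)) ->
  (forall k, k < n ->
     all (fun t => Q (F t)) (body f (chosen f x k) (run f x k))) ->
  Q (\max_(s <- trace f x n) F s).
Proof.
move=> xP Q0 Qi Qb; rewrite /trace big_cons big_flatten big_map.
have Qmax i j : Q i -> Q j -> Q (maxn i j) by rewrite /maxn; case: ifP.
apply: (Qmax) => //; rewrite big_seq; apply: (big_ind Q) => [//|//|k].
by rewrite mem_iota /= => /Qb; rewrite queue_run //; apply: bigmax_all.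
Qed.

(** After the extraction the queue never shrinks again within the iteration, so the invariant at
    both ends controls the intermediate states. *)
Lemma body_queue_size f d s e : loop_invariant f d s -> e \in queue s ->
  all (fun t => size (queue t) <=
                maxn (size (queue s)) (size (queue (last s (body f e s)))))
    (body f e s).
Proof.
move=> inv es; have [_ [l [r [sE pl _]]]] := invariant_split inv es.
case: s sE es {inv} => M F; rewrite [pairs _]/= => -> eF.
have := size_rem eF; move: eF; rewrite bodyE //= => eF sz.
by rewrite !size_cat sz !leq_max; lia.
Qed.

Lemma max_queue_bound f x n : extracts_min x ->
  max_queue_length f x n * (max_queue_length f x n).-1 <= n.*2.
Proof.
move=> xP; apply: (max_trace (Q := fun m => m * m.-1 <= n.*2)) => // k kn.
have inv := run_invariant f xP k; have pk := chosen_mem f xP k.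
apply: sub_all (body_queue_size inv pk) => t; rewrite -/(chosen f x k).
have := invariant_size inv; have := invariant_size (invariant_body inv pk).
rewrite size_rcons size_mkseq; set a := size _; set b := size (queue (run _ _ _)).
set c := size _; move=> ha hb.
have h m : m * m.-1 <= k.+1.*2 -> c <= m -> c * c.-1 <= n.*2.
  move=> h1 cm; apply: (@leq_trans (k.+1.*2)); last by rewrite leq_double.
  apply: leq_trans h1; apply: leq_mul => //.
  by rewrite -!subn1 leq_sub2r.
rewrite /maxn; case: ifP => _; first exact: h.
by apply: h; apply: leq_trans hb _; rewrite leq_double.
Qed.

(** What the cost estimates need to know about a state. Unlike [loop_invariant], it can be stated
    for the intermediate states of an iteration too, where list and queue do not match. *)
Definition within (f : nat -> nat -> int) (n m : nat) (s : state) : bool :=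
  [&& all (le2^~ (n, n)) (pairs s),
      all (fun e => (e == entry_of f e.2) && le2 e.2 (n, n)) (queue s),
      size (pairs s) <= m & size (queue s) <= m].

Lemma invariant_within f d s n : loop_invariant f d s -> size d <= n ->
  within f n (size (queue s)) s.
Proof.
move=> inv dn; have pn p : p \in pairs s -> le2 p (n, n).
  move=> /(invariant_coord inv)[a b].
  by rewrite /le2 (leq_trans a dn) (leq_trans b dn).
have [_ _ _ qE] := inv; rewrite /within leqnn andbT.
rewrite -(size_map (entry_of f) (pairs s)) (perm_size qE) leqnn andbT.
apply/andP; split; first exact/allP.
by apply/allP => e; rewrite (perm_mem qE) => /mapP[p /pn h ->] /=; rewrite eqxx.
Qed.

(** Up to two nodes are inserted before the old one is removed, hence [.+2]. Coordinates grow by at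
    most one from a value at most [size d], which is less than [n]. *)
Lemma body_within f d s e n :
  loop_invariant f d s -> e \in queue s -> size d < n ->
  all (within f n (size (queue s)).+2) (body f e s).
Proof.
move=> inv es dn; have /and4P[ps qs sp sq] := invariant_within inv (ltnW dn).
have [ee [l [r [sE pl _]]]] := invariant_split inv es.
have ep : e.2 \in pairs s by rewrite sE mem_cat mem_head orbT.
have [e1 e2] := invariant_coord inv ep.
have an : le2 (e.2.1.+1, e.2.2) (n, n).
  by rewrite /le2 /= (leq_ltn_trans e1) // ltnW // (leq_ltn_trans e2).
have bn : le2 (e.2.1, e.2.2.+1) (n, n).
  by rewrite /le2 /= (leq_ltn_trans e2) // ltnW // (leq_ltn_trans e1).
case: s sE es ps qs sp sq {inv ep} => M F; rewrite [pairs _]/= => ->.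
rewrite [queue _]/= => eF ps qs sp sq; rewrite bodyE //=.
have {}qs : all (fun e => (e == entry_of f e.2) && le2 e.2 (n, n)) (rem e F).
  by apply/allP => e' /mem_rem; apply: (allP qs).
have sr : size (rem e F) <= size F by rewrite size_rem // leq_pred.
move: ps sp; rewrite all_cat size_cat /= => /and3P[pl' pe pr] sp.
have an' : all (le2^~ (n, n)) (next_a e.2 r) by rewrite all_nseq an orbT.
have bn' : all (le2^~ (n, n)) (next_b e.2 l) by rewrite all_nseq bn orbT.
have next_q q k : le2 q (n, n) ->
  all (fun e => (e == entry_of f e.2) && le2 e.2 (n, n))
    (map (entry_of f) (nseq k q)).
  by move=> h; rewrite all_map all_nseq /= eqxx h orbT.
rewrite /within !(all_cat, size_cat, size_map) /= !(all_cat, size_cat).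
rewrite qs pl' pe pr an' bn' !next_q ?an ?bn //=.
move: (size (rem e F)) (size F) (size l) (size r) sr sp => i j k m ij kmj.
rewrite /next_a /next_b !size_nseq; case: enters_a; case: enters_b => /=.
all: lia.
Qed.

(** * Bit lengths of products and powers *)

Lemma bit_length_ltn n : n < 2 ^ bit_length n.
Proof. exact: trunc_log_ltn. Qed.

Lemma bit_length_leq n k : 0 < k -> n < 2 ^ k -> bit_length n <= k.
Proof.
case: n => [|n] k0 nk; first by rewrite /bit_length trunc_log0.
rewrite /bit_length -(ltn_exp2l _ _ (isT : 1 < 2)).
by apply: leq_ltn_trans nk; apply: trunc_logP.
Qed.

Lemma leq_bit_length m n : m <= n -> bit_length m <= bit_length n.
Proof.
by move=> mn; apply: bit_length_leq => //; apply: leq_ltn_trans (bit_length_ltn n).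
Qed.

Lemma bit_length_mul m n : bit_length (m * n) <= bit_length m + bit_length n.
Proof.
apply: bit_length_leq => //; rewrite expnD.
by apply: ltn_mul; exact: bit_length_ltn.
Qed.

Lemma bit_length_exp m k : bit_length (m ^ k) <= (k * bit_length m).+1.
Proof.
case: k => [|k]; apply: bit_length_leq => //.
rewrite [2 ^ _]expnS [k.+1 * _]mulnC expnM.
apply: (@leq_ltn_trans ((2 ^ bit_length m) ^ k.+1)).
  by rewrite leq_exp2r // ltnW // bit_length_ltn.
by rewrite ltn_Pmull // !expn_gt0.
Qed.

(** For [n] at least 2, [n.+2 <= n * n]. *)
Lemma bit_length_add2 n : 1 < n -> bit_length n.+2 <= 2 * bit_length n.
Proof.
move=> n1; apply: (@leq_trans (bit_length (n * n))); last first.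
  by rewrite mul2n -addnn bit_length_mul.
by apply: leq_bit_length; nia.
Qed.

(** * Time and memory in terms of a bound [E] on the bits of one entry *)

Section Cost.

Variables (c : cost_model) (f : nat -> nat -> int) (n E : nat).
Hypothesis leE : forall q, le2 q (n, n) ->
  bit_length n + entry_bits (entry_of f q) <= E.

(** Bound for the time and for the space of a single entry. *)
Let W := cost_constant c * E.

Lemma entry_timeE q : le2 q (n, n) -> entry_time c n (entry_of f q) <= W.
Proof. by move=> /leE h; apply: leq_trans (entry_timeP _ _ _) _; rewrite leq_mul. Qed.

Lemma entry_spaceE q : le2 q (n, n) -> entry_space c n (entry_of f q) <= W.
Proof. by move=> /leE h; apply: leq_trans (entry_spaceP _ _ _) _; rewrite leq_mul. Qed.

Lemma state_spaceE m s : within f n m s -> state_space c f n s <= 2 * (m * W).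
Proof.
case/and4P=> /allP ps /allP qs sp sq; rewrite mul2n -addnn leq_add //.
- apply: (@leq_trans (\sum_(p <- pairs s) W)).
    by rewrite big_seq [leqRHS]big_seq; apply: leq_sum => p /ps/entry_spaceE.
  by rewrite big_const_seq count_predT iter_addn_0 mulnC leq_mul.
- apply: (@leq_trans (\sum_(p <- queue s) W)).
    rewrite big_seq [leqRHS]big_seq; apply: leq_sum => e /qs/andP[/eqP->].
    exact: entry_spaceE.
  by rewrite big_const_seq count_predT iter_addn_0 mulnC leq_mul.
Qed.

(* A bound for the time of each single operation of the algorithm. *)
Let X := (cost_constant c).+1 ^ 2 * bit_length n.+2 * E.

Lemma leE_bit_length : bit_length n <= E.
Proof. by apply: leq_trans (leE (_ : le2 (0, 0) (n, n))); rewrite ?leq_addr. Qed.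

Lemma leWX : W <= X.
Proof.
rewrite /X /W leq_mul2r; apply/orP; right.
have : 0 < bit_length n.+2 by []; nia.
Qed.

Lemma list_timeX : list_time c n <= X.
Proof.
by apply: leq_trans (list_timeP _ _) (leq_trans _ leWX);
  rewrite leq_mul // leE_bit_length.
Qed.

Lemma queue_timeX m s :
  within f n m s -> m <= n.+2 -> queue_time c n (queue s) <= X.
Proof.
case/and4P=> _ /allP qs _ sq mn.
apply: (@leq_trans (cost_constant c * bit_length n.+2 * W)).
  apply: leq_mul.
    apply: leq_trans (queue_stepsP _ _) _.
    rewrite leq_mul2l leq_bit_length ?orbT //.
    exact: leq_trans sq mn.
  by apply/bigmax_leqP_seq => e /qs/andP[/eqP->] /entry_timeE.
rewrite /X /W mulnA leq_mul2r; apply/orP; right.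
rewrite -mulnA [bit_length _ * _]mulnC mulnA leq_mul2r mulnn.
by rewrite leq_exp2r ?leqnSn ?orbT.
Qed.

Lemma oapp_onth_leq (g : nat * nat -> nat) (M : seq (nat * nat)) i B :
  all (fun q => g q <= B) M -> oapp g 0 (onth M i) <= B.
Proof.
move=> /allP MB; case E1: (onth M i) => [q|] //=; apply: MB.
by apply/onthP; exists i.
Qed.

(** Six operations: finding the neighbour, computing the candidate, reading the two entries
    compared, and the insertions into list and queue. *)
Lemma extend_timeX m s s' o q b :
  within f n m s -> within f n m s' -> m <= n.+2 ->
  (o = None \/ exists i, o = onth (pairs s) i) -> le2 q (n, n) ->
  extend_time c f n o q b (queue s') <= 6 * X.
Proof.
move=> ws ws' mn oE qn; rewrite /extend_time.
have h1 := leq_trans (entry_timeE qn) leWX; have h2 := list_timeX.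
have h3 := queue_timeX ws' mn.
have h4 : oapp (fun q' => entry_time c n (entry_of f q')) 0 o <= X.
  case: oE => [->//|[i ->]]; apply: oapp_onth_leq; case/and4P: ws => ps _ _ _.
  by apply: sub_all ps => p /entry_timeE h; apply: leq_trans h leWX.
by case: b; lia.
Qed.

Lemma body_timeX d s e : loop_invariant f d s -> e \in queue s -> size d < n ->
  body_time c f n e s <= 15 * X.
Proof.
move=> inv es dn; have ws := invariant_within inv (ltnW dn).
(* A linear bound is enough here, as the queue length enters the time only through its logarithm. *)
have mn : (size (queue s)).+2 <= n.+2.
  rewrite !ltnS; have h := invariant_size inv.
  by rewrite leqNgt; apply/negP => qn; nia.
have [ee [l [r [sE pl _]]]] := invariant_split inv es.
have ep : e.2 \in pairs s by rewrite sE mem_cat mem_head orbT.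
have [e1 e2] := invariant_coord inv ep.
have /and4P[w1 w2 w3 _] := body_within inv es dn.
have qs := queue_timeX ws (ltnW (ltnW mn)).
rewrite /body_time.
have hl := list_timeX.
have he : entry_time c n e <= X.
  rewrite ee; apply: leq_trans leWX; apply: entry_timeE.
  by case/and4P: ws => /allP/(_ _ ep).
have ha : extend_time c f n (list_succ (pairs (extract e s)) e.2)
      (e.2.1.+1, e.2.2) (fits_a (pairs (extract e s)) e.2)
      (queue (extend_a f e.2 (extract e s))) <= 6 * X.
  apply: (extend_timeX _ w1 w2 mn).
    by right; exists (index e.2 (pairs (extract e s))).+1.
  by rewrite /le2 /= (leq_ltn_trans e1) // ltnW // (leq_ltn_trans e2).
set s2 := extend_a f e.2 (extract e s) in w2 w3 ha *.
have hb : extend_time c f n (list_pred (pairs s2) e.2) (e.2.1, e.2.2.+1)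
      (fits_b (pairs s2) e.2) (queue (extend_b f e.2 s2)) <= 6 * X.
  apply: (extend_timeX _ w2 w3 mn).
    rewrite /list_pred; case: index => [|i]; first by left.
    by right; exists i.
  by rewrite /le2 /= (leq_ltn_trans e2) // ltnW // (leq_ltn_trans e1).
(* Extraction, output, the two candidates, removal of the node. *)
have -> : 15 * X = X + X + 6 * X + 6 * X + X by lia.
by do 4 (apply: leq_add => //).
Qed.

Lemma init_timeX : init_time c f n <= 3 * X.
Proof.
have wi : within f n 1 (init f) by rewrite /within /= eqxx.
have := queue_timeX wi (isT : 1 <= n.+2); have := list_timeX.
have := leq_trans (entry_timeE (isT : le2 (0, 0) (n, n))) leWX.
rewrite /init_time; lia.
Qed.

Variable (x : nat -> seq entry -> entry).
Hypothesis xP : extracts_min x.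

(** Each iteration costs at most [15 * X]; as [n] is positive, the initial [3 * X] is absorbed into
    [3 * n * X]. *)
Lemma total_timeX : 0 < n -> total_time c f x n <= 18 * n * X.
Proof.
move=> n0; apply: (@leq_trans (3 * X + n * (15 * X))); last by nia.
apply: leq_add; first exact: init_timeX.
apply: (@leq_trans (\sum_(k < n) 15 * X)); last first.
  by rewrite sum_nat_const card_ord.
apply: leq_sum => k _; cbv zeta; rewrite queue_run //.
apply: (body_timeX (run_invariant f xP k)); first exact: chosen_mem.
by rewrite size_mkseq.
Qed.

(** Here [m] is the queue length at the start of an iteration, to which the square root bound
    applies; [m.+2] allows for the two insertions. *)
Lemma total_spaceX (Q : pred nat) :
  (forall v m, m * m.-1 <= n.*2 -> v <= 2 * (m.+2 * W) -> Q v) ->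
  Q (total_space c f x n).
Proof.
move=> QP; apply: max_trace => //.
- exact: (QP _ 0).
- apply: (QP _ 0) => //; apply: state_spaceE.
  by rewrite /within /= eqxx.
move=> k kn; have inv := run_invariant f xP k.
have kd : size (mkseq (fun k => (chosen f x k).2) k) < n by rewrite size_mkseq.
apply: sub_all (body_within inv (chosen_mem f xP k) kd) => t wt.
apply: QP (state_spaceE wt); apply: leq_trans (invariant_size inv) _.
by rewrite leq_double ltnW.
Qed.

End Cost.

(** * Polynomial growth and the passage to real logarithms and roots *)

Local Open Scope ring_scope.

Lemma norm_horner_le (R : numDomainType) (p : {poly R}) (x N : R) (d : nat) :
  1 <= N -> `|x| <= N -> (size p <= d)%N ->
  `|p.[x]| <= (\sum_(i < size p) `|p`_i|) * N ^+ d.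
Proof.
move=> N1 xN pd; rewrite horner_coef mulr_suml.
apply: le_trans (ler_norm_sum _ _ _) _; apply: ler_sum => i _.
rewrite normrM normrX ler_wpM2l //.
apply: (@le_trans _ _ (N ^+ i)); first by rewrite lerXn2r ?nnegrE // (le_trans _ N1).
by rewrite ler_weXn2l // (leq_trans _ pd) // ltnW.
Qed.

Lemma polynomial_growth (R : realType) (f : nat -> nat -> int) :
  is_polynomial R f -> exists K d : nat, forall n a b : nat,
    (0 < n)%N -> (a <= n)%N -> (b <= n)%N -> (`|f a b| <= K * n ^ d)%N.
Proof.
case=> p pE; pose d := (\max_(j < size p) size (p`_j)%R)%N.
pose S := \sum_(j < size p) \sum_(i < size p`_j) `|p`_j`_i|.
(* [S] sums the absolute values of all coefficients; [d] accounts for the powers of [a] and [size p]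
   for those of [b]. *)
exists (Num.bound S), (d + size p)%N => n a b n0 an bn.
rewrite -(ler_nat R) natrM natrX.
have -> : (`|f a b|%N%:R : R) = `|(f a b)%:~R| by rewrite -intr_norm natr_absz.
have n1 : 1 <= n%:R :> R by rewrite ler1n.
have n0' : 0 <= n%:R :> R by [].
have S0 : 0 <= S by do 2 (apply: sumr_ge0 => ? _).
apply: (@le_trans _ _ (S * n%:R ^+ (d + size p))); last first.
  by rewrite ler_wpM2r ?exprn_ge0 // ltW // archi_boundP.
rewrite pE (horner_coef p) horner_sum /S mulr_suml.
apply: le_trans (ler_norm_sum _ _ _) _; apply: ler_sum => j _.
rewrite -polyC_exp hornerM hornerC normrM exprD mulrA ler_pM //.
  apply: norm_horner_le => //; first by rewrite normr_nat ler_nat.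
  exact: leq_bigmax.
rewrite normrX normr_nat; apply: (@le_trans _ _ (n%:R ^+ j)).
  by rewrite lerXn2r ?nnegrE // ler_nat.
by rewrite ler_weXn2l // ltnW.
Qed.

Lemma entry_bits_polynomial (R : realType) (f : nat -> nat -> int) :
  is_polynomial R f -> exists L : nat, forall n q, (0 < n)%N -> le2 q (n, n) ->
    (bit_length n + entry_bits (entry_of f q) <= L * bit_length n)%N.
Proof.
move=> /polynomial_growth[K [d fK]].
(* The value has at most [bit_length K + d * bit_length n + 1] bits. The 4 covers this 1, the
   pointer term and the two coordinates. *)
exists (bit_length K + d + 4)%N => n q n0 /andP[/= an bn].
have h1 := leq_bit_length an; have h2 := leq_bit_length bn.
have h3 := leq_bit_length (fK n q.1 q.2 n0 an bn).
have h4 := leq_trans h3 (bit_length_mul _ _).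
have h5 := bit_length_exp n d.
have : (0 < bit_length n)%N by [].
rewrite /entry_bits /entry_of /=; move: h1 h2 h4 h5 {h3}.
move: (bit_length q.1) (bit_length q.2) (bit_length `|f q.1 q.2|%N).
move: (bit_length (n ^ d)) (bit_length n) (bit_length K) => *; nia.
Qed.

(** For [n] at least 2 the rounded logarithm is positive, so adding 1 at most doubles it. *)
Lemma bit_length_ln (R : realType) (n : nat) : (1 < n)%N ->
  (bit_length n)%:R <= 2 / ln 2 * ln (n%:R) :> R.
Proof.
move=> n1; have ln2 : 0 < ln (2 : R) by rewrite ln_gt0 // ltr1n.
rewrite mulrAC ler_pdivlMr //.
apply: (@le_trans _ _ (2 * ((trunc_log 2 n)%:R * ln 2))).
  rewrite mulrA ler_wpM2r ?(ltW ln2) // -natrM ler_nat.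
  have : (0 < trunc_log 2 n)%N by rewrite trunc_log_gt0.
  by rewrite /bit_length; lia.
rewrite ler_wpM2l // mulr_natl -lnXn //.
rewrite ler_ln ?posrE ?exprn_gt0 // ?ltr0n ?(ltnW n1) //.
by rewrite -natrX ler_nat trunc_logP // ltnW.
Qed.

(** The square of [m.-1] is at most [m * m.-1]. *)
Lemma le_sqrt_double (R : realType) (m n : nat) : (m * m.-1 <= n.*2)%N ->
  m%:R <= Num.sqrt (2 * n%:R) + 1 :> R.
Proof.
case: m => [_|m h]; first by rewrite addr_ge0 // sqrtr_ge0.
rewrite -natr1 lerD2r -(@ger0_norm _ (m%:R : R)) // -sqrtr_sqr ler_wsqrtr //.
rewrite -natrX -natrM ler_nat mul2n; apply: leq_trans h.
by rewrite -mulnn leq_mul.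
Qed.

Theorem theorem1 (R : realType) (f : nat -> nat -> int)
    (f_bimonotone : bimonotone f) (f_proper : proper_fun f) :
  (forall x : nat -> seq entry -> entry, extracts_min x ->
     (exists u : nat -> nat * nat,
        [/\ forall k : nat, output f x k = Some (u k),
            bijective u
          & forall j k : nat, (j <= k)%N ->
              f (u j).1 (u j).2 <= f (u k).1 (u k).2])
     /\ (forall n : nat,
           (max_queue_length f x n)%:R <= Num.sqrt (2 * n%:R) + 1 :> R))
  /\ (is_polynomial R f ->
      forall c : cost_model,
      exists C : R,
      forall x : nat -> seq entry -> entry, extracts_min x ->
      forall n : nat, (1 < n)%N ->
        (total_time c f x n)%:R <= C * (n%:R * ln (n%:R : R) ^+ 2)
        /\ (total_space c f x n)%:R <= C * (Num.sqrt n%:R * ln (n%:R : R))).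
Proof.
split=> [x xP|/entry_bits_polynomial[L fL] c].
  split=> [|n]; last by apply: le_sqrt_double; exact: max_queue_bound.
  exists (fun k => (chosen f x k).2); split.
  - by move=> k; rewrite /output queue_run.
  - exact: out_bij.
  - by move=> j k; apply: out_mono.
pose B : R := 2 / ln 2.
(* [K1] and [K2] collect the constants of [total_timeX] and [total_spaceX] with [E] equal to
   [L * bit_length n]; the 2 in [K1] comes from [bit_length_add2]. [B] converts bit lengths to
   natural logarithms. *)
pose K1 : R := (18 * ((cost_constant c).+1 ^ 2 * 2 * L))%:R.
pose K2 : R := (2 * (cost_constant c * L))%:R.
have K10 : 0 <= K1 by exact: ler0n.
have K20 : 0 <= K2 by exact: ler0n.
exists (K1 * B ^+ 2 + K2 * 5 * B) => x xP n n1.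
have n0 := ltnW n1.
have ln0 : 0 < ln (n%:R : R) by rewrite ln_gt0 // ltr1n.
have B0 : 0 <= B by rewrite divr_ge0 // ln_ge0 // ler1n.
have bB : (bit_length n)%:R <= B * ln n%:R :> R := bit_length_ln R n1.
have fLn q := fL n q n0.
move: (B) B0 bB => {}B B0 bB.
split.
- apply: (@le_trans _ _ (K1 * B ^+ 2 * (n%:R * ln (n%:R : R) ^+ 2))); last first.
    by rewrite ler_wpM2r ?mulr_ge0 ?exprn_ge0 ?(ltW ln0) // lerDl !mulr_ge0.
  apply: (@le_trans _ _ (K1 * (n%:R * (bit_length n)%:R ^+ 2))); last first.
    rewrite -[K1 * _ * _]mulrA ler_wpM2l // [B ^+ 2 * _]mulrCA ler_wpM2l // -exprMn.
    by rewrite lerXn2r ?nnegrE ?mulr_ge0 // (ltW ln0).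
  rewrite /K1 -natrX -!natrM ler_nat.
  apply: leq_trans (total_timeX c fLn xP n0) _.
  have := bit_length_add2 n1; move: (bit_length _) (bit_length _) => u v uv.
  move: ((cost_constant c).+1 ^ 2)%N => cc.
  apply: (@leq_trans (18 * n * (cc * (2 * u) * (L * u)))).
    by do 3 (apply: leq_mul => //).
  by rewrite -mulnn; nia.
- pose r := K2 * 5 * B * (Num.sqrt n%:R * ln (n%:R : R)).
  apply: (@le_trans _ _ r); last first.
    by rewrite ler_wpM2r ?mulr_ge0 ?sqrtr_ge0 ?(ltW ln0) // lerDr mulr_ge0 ?exprn_ge0.
  apply: (total_spaceX (Q := fun v => v%:R <= r) fLn xP) => v m mn vm.
  apply: (@le_trans _ _ (2 * (m.+2 * (cost_constant c * (L * bit_length n))))%:R).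
    by rewrite ler_nat.
  (* The 5 arises from [m + 2 <= Num.sqrt (2 * n) + 3], where the root is at most [2 * Num.sqrt n]
     and 3 at most [3 * Num.sqrt n]. *)
  apply: (@le_trans _ _ (K2 * ((5 * Num.sqrt n%:R) * (bit_length n)%:R))); last first.
    rewrite /r -!mulrA ler_wpM2l // ler_wpM2l // mulrCA ler_wpM2l ?sqrtr_ge0 //.
  have -> : (2 * (m.+2 * (cost_constant c * (L * bit_length n))) =
             2 * (cost_constant c * L) * (m.+2 * bit_length n))%N by lia.
  rewrite natrM ler_wpM2l // natrM ler_wpM2r //.
  have sn1 : 1 <= Num.sqrt n%:R :> R.
    by rewrite -{1}sqrtr1 ler_wsqrtr // ler1n.
  have s2 : Num.sqrt (2 * n%:R) <= 2 * Num.sqrt n%:R :> R.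
    rewrite sqrtrM // ler_wpM2r ?sqrtr_ge0 // -{2}[2]ger0_norm // -sqrtr_sqr.
    by rewrite ler_wsqrtr // -natrX ler_nat.
  rewrite -addn2 natrD; have := le_sqrt_double R mn => hm.
  by lra.
Qed.
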